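(* Let $d\ge2$ and let $\theta=(\theta_{ij})_{1\le i+j\le d}\in\mathbb{R}^N$ (with $N$ the number of pairs of nonnegative integers $(i,j)$ with $1\le i+j\le d$). Let $p(x;\theta)=\theta_{d0}x^d+\theta_{d-1,1}x^{d-1}+\dots+\theta_{1,d-1}x+\theta_{0d}$ and let $D(\theta)$ be the discriminant of $p(x;\theta)=0$ (as a polynomial in the coefficients). Define $$\Theta'=\{\theta: p(a;\theta)<0\ \forall a\ge0,\ \theta_{0d}<0,\ \theta_{d0}<0\},$$ $$\Theta''=\{\theta:\theta_{d0}<0,\ \theta_{0d}<0\}\setminus\{\theta: D(\theta)=0\},$$ let $\Theta''_i$, $i\in I$, be the connected components of $\Theta''$, and let $I^*=\{i\in I:\Theta''_i\cap\Theta'\neq\emptyset\}$. Then, except for a set of Lebesgue measure zero, $$\Theta'=\bigcup_{i\in I^*}\Theta''_i .$$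
   Context: $\Theta'$ is the parameter space of the proper order-$d$ bivariate exponential-polynomial model with density proportional to $\exp(\sum_{1\le i+j\le d}\theta_{ij}x^iy^j)$ on the positive orthant. *)

(* Defs.v *)
From HB Require Import structures.
From mathcomp Require Import all_boot all_order all_algebra.
From mathcomp Require Import all_classical all_reals all_analysis.
Set Implicit Arguments. Unset Strict Implicit. Unset Printing Implicit Defensive.
Import Order.TTheory GRing.Theory Num.Theory.
Import numFieldNormedType.Exports.
Local Open Scope classical_set_scope.
Local Open Scope ring_scope.

Definition idx (d : nat) : finType :=
  {ij : 'I_d.+1 * 'I_d.+1 | (0 < ij.1 + ij.2 <= d)%N}.

(* N = number of such pairs; the parameter space is R^N = 'rV[R]_N,
   coordinates enumerated by enum_rank. *)
Definition Npar (d : nat) : nat := #|{: idx d}|.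

Section Defs.
Variable R : realType.

(* theta_{ij}; returns 0 for pairs outside the index set (never used). *)
Definition th (d : nat) (theta : 'rV[R]_(Npar d)) (i j : nat) : R :=
  match @insub _ (fun ij : 'I_d.+1 * 'I_d.+1 => (0 < ij.1 + ij.2 <= d)%N)
          (idx d) (inord i, inord j) with
  | Some ij => theta ord0 (enum_rank ij)
  | None => 0
  end.

Definition ptheta (d : nat) (theta : 'rV[R]_(Npar d)) : {poly R} :=
  \sum_(k < d.+1) th theta (d - k) k *: 'X^(d - k).

Definition Dtheta (d : nat) (theta : 'rV[R]_(Npar d)) : R :=
  (-1) ^+ (d * d.-1)./2 * resultant (ptheta theta) (ptheta theta)^`()
  / lead_coef (ptheta theta).

Definition Theta1 (d : nat) : set 'rV[R]_(Npar d) :=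
  [set theta | (forall a : R, 0 <= a -> (ptheta theta).[a] < 0)
               /\ th theta 0 d < 0 /\ th theta d 0 < 0].

Definition Theta2 (d : nat) : set 'rV[R]_(Npar d) :=
  [set theta | th theta d 0 < 0 /\ th theta 0 d < 0] `\`
  [set theta | Dtheta theta = 0].

Definition Theta2_star (d : nat) : set 'rV[R]_(Npar d) :=
  [set theta | @Theta2 d theta /\
     (connected_component (@Theta2 d) theta `&` @Theta1 d) !=set0].

Definition box (n : nat) (a b : 'rV[R]_n) : set 'rV[R]_n :=
  [set x | forall i, a ord0 i <= x ord0 i <= b ord0 i].

Definition lebesgue_null (n : nat) (A : set 'rV[R]_n) : Prop :=
  forall eps : R, 0 < eps ->
  exists a b : nat -> 'rV[R]_n,
    (forall k i, a k ord0 i <= b k ord0 i) /\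
    A `<=` \bigcup_k box (a k) (b k) /\
    (forall m, \sum_(k < m) \prod_(i < n) (b k ord0 i - a k ord0 i) <= eps).
End Defs.

(* Main.v *)
Require Import Defs.
From HB Require Import structures.
From mathcomp Require Import all_boot all_order all_algebra separable.
From mathcomp Require Import all_classical all_reals all_analysis.
From mathcomp Require Import zify ring lra.
Import Order.TTheory GRing.Theory Num.Theory.
Import numFieldNormedType.Exports.
Local Open Scope classical_set_scope.
Local Open Scope ring_scope.
Set Implicit Arguments. Unset Strict Implicit. Unset Printing Implicit Defensive.

(* Theta1 is both open and closed in Theta2. Open: by homogeneity, negativity of
   p on [0, +oo[ together with the sign conditions is negativity of p and of its
   reversal on the compact [0, 1]. Closed: a limit point has p <= 0 on
   [0, +oo[, so a zero of p there would be a double root, which Theta2 excludes.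
   Hence a component of Theta2 that meets Theta1 lies in Theta1, and the symmetric
   difference is contained in the discriminant hypersurface D = 0. That
   hypersurface is null: on it p = F^2 V with F monic of positive degree, and the
   coefficients of F and V are fewer than those of p, so it is a countable union
   of locally Lipschitz images of a space of smaller dimension. *)

(** * Null sets through covers by boxes *)

Lemma ler_sum_uniq_subset (R : numDomainType) (I : eqType) (s t : seq I)
    (F : I -> R) :
  (forall i, 0 <= F i) -> uniq s -> {subset s <= t} ->
  \sum_(i <- s) F i <= \sum_(i <- t) F i.
Proof.
move=> F0; elim: s t => [|x s IH] t /=.
  by rewrite big_nil sumr_ge0.
case/andP=> xs us st.
have xt : x \in t by apply: st; rewrite mem_head.
rewrite (perm_big _ (perm_to_rem xt)) /= !big_cons lerD2l IH // => y ys.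
have := st y; rewrite inE ys orbT (perm_mem (perm_to_rem xt)) inE => /(_ isT).
by case/orP=> // /eqP yx; rewrite -yx ys in xs.
Qed.

Section NullSets.
Variables (R : realType) (n : nat).
Implicit Types (a b : 'rV[R]_n) (A : set 'rV[R]_n).

Definition box_volume a b : R := \prod_(i < n) (b ord0 i - a ord0 i).

Lemma box_volume_ge0 a b :
  (forall i, a ord0 i <= b ord0 i) -> 0 <= box_volume a b.
Proof. by move=> ab; apply: prodr_ge0 => i _; rewrite subr_ge0. Qed.

Lemma lebesgue_null_countable_cover A : (0 < n)%N ->
  (forall eps : R, 0 < eps -> exists (I : countType) (a b : I -> 'rV[R]_n),
    [/\ forall k i, a k ord0 i <= b k ord0 i,
        A `<=` \bigcup_k box (a k) (b k) &
        forall s : seq I, uniq s -> \sum_(k <- s) box_volume (a k) (b k) <= eps]) ->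
  lebesgue_null A.
Proof.
move=> n0 H eps eps0; have [I [a [b [ab Acov vol]]]] := H _ eps0.
exists (fun k => oapp a 0 (pickle_inv k)), (fun k => oapp b 0 (pickle_inv k)).
split; first by move=> k i; case: (pickle_inv k) => /=.
split.
  move=> x /Acov [k _ xk]; exists (pickle k) => //.
  by rewrite pickleK_inv.
move=> m; rewrite -(big_mkord xpredT
  (fun k => box_volume (oapp a 0 (pickle_inv k)) (oapp b 0 (pickle_inv k)))).
rewrite (eq_bigr (fun k => oapp (fun i => box_volume (a i) (b i)) 0
  (@pickle_inv I k))).
  rewrite -big_pmap; apply: vol; apply: (pmap_uniq pickle_invK).
  exact: iota_uniq.
move=> k _; case: (pickle_inv k) => //=.
by rewrite /box_volume (bigD1 (Ordinal n0)) //= subrr mul0r.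
Qed.

Lemma lebesgue_null_bigcup (A : nat -> set 'rV[R]_n) : (0 < n)%N ->
  (forall j, lebesgue_null (A j)) -> lebesgue_null (\bigcup_j A j).
Proof.
move=> n0 nullA; apply: lebesgue_null_countable_cover => // eps eps0.
(* The [j]-th set receives [eps / 2^(j+1)]; these budgets add up to [eps]. *)
have epsj j : 0 < geometric (eps / 2) (2^-1) j.
  by rewrite /geometric /= mulr_gt0 ?divr_gt0 ?exprn_gt0 ?invr_gt0.
have /choice[a /choice[b H]] j := nullA j _ (epsj j).
exists (nat * nat)%type, (fun p => a p.1 p.2), (fun p => b p.1 p.2); split.
- by move=> [j k] i; have [+ _] := H j; apply.
- move=> x [j _ xA]; have [_ [/(_ _ xA) [k _ xk] _]] := H j.
  by exists (j, k).
(* A finite list of pairs lies in a square [t], over which the sum is taken row by row. *)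
move=> s us; pose m := (\max_(p <- s) maxn p.1 p.2).+1.
pose t := [seq (j, k) | j <- iota 0 m, k <- iota 0 m].
have vol0 (p : nat * nat) : 0 <= box_volume (a p.1 p.2) (b p.1 p.2).
  by apply: box_volume_ge0 => i; have [+ _] := H p.1; apply.
have st : {subset s <= t}.
  move=> [j k] js; apply/allpairsP; exists (j, k); rewrite !mem_iota /= !add0n !ltnS.
  have := @leq_bigmax_seq _ s (fun=> true) (fun p => maxn p.1 p.2) (j, k) js isT.
  by rewrite /= geq_max => /andP[-> ->].
apply: le_trans (ler_sum_uniq_subset vol0 us st) _.
rewrite big_allpairs /=.
apply: (@le_trans _ _ (series (geometric (eps / 2) (2^-1)) m)).
  rewrite /series /= /index_iota subn0; apply: ler_sum => j _.
  have [_ [_ /(_ m)]] := H j.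
  rewrite -(big_mkord xpredT (fun k => box_volume (a j k) (b j k))).
  by rewrite /index_iota subn0.
apply: le_trans (geometric_le_lim _ _ _ _) _.
- by rewrite divr_ge0 // ltW.
- by rewrite invr_gt0.
- by rewrite ger0_norm ?invf_lt1 ?invr_ge0 ?ltr1n.
have -> : 1 - 2^-1 = 2^-1 :> R by lra.
by rewrite invrK divfK.
Qed.

Lemma lebesgue_null_subset A B : A `<=` B -> lebesgue_null B -> lebesgue_null A.
Proof.
move=> AB nullB eps /nullB [a [b [ab [Bcov vol]]]]; exists a, b.
by split=> //; split=> // x /AB /Bcov.
Qed.

End NullSets.

(** * Locally Lipschitz maps into a space of larger dimension *)

Section LocallyLipschitz.
Variables (R : realType) (T : finType).
Implicit Types (x y : T -> R) (g : (T -> R) -> R).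

(** The sup distance is encoded by a common coordinate bound [h]; its sign is explicit because [T]
    may be empty. *)
Definition locally_lipschitz g := forall K : R, exists2 L : R, 0 <= L &
  forall x y (h : R), (forall t, `|x t| <= K) -> (forall t, `|y t| <= K) -> 0 <= h ->
    (forall t, `|x t - y t| <= h) -> `|g x - g y| <= L * h.

Lemma locally_lipschitz_cst c : locally_lipschitz (fun=> c).
Proof. by move=> K; exists 0 => // x y h _ _ h0 _; rewrite subrr normr0 mul0r. Qed.

Lemma locally_lipschitz_proj t : locally_lipschitz (fun x => x t).
Proof. by move=> K; exists 1 => // x y h _ _ h0 /(_ t); rewrite mul1r. Qed.

Lemma locally_lipschitzD f g : locally_lipschitz f -> locally_lipschitz g ->
  locally_lipschitz (fun x => f x + g x).
Proof.
move=> lf lg K; have [L L0 fL] := lf K; have [M M0 gM] := lg K.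
exists (L + M) => [|x y h xK yK h0 xy]; first exact: addr_ge0.
rewrite opprD addrACA mulrDl (le_trans (ler_normD _ _)) // lerD //.
  exact: fL.
exact: gM.
Qed.

Lemma locally_lipschitz_bounded g K : locally_lipschitz g ->
  exists2 B : R, 0 <= B & forall x, (forall t, `|x t| <= K) -> `|g x| <= B.
Proof.
(* The absolute value keeps the origin, the point of comparison, inside the cube. *)
move=> lg; have [L L0 gL] := lg `|K|.
exists (`|g (fun=> 0)| + L * `|K|) => [|x xK].
  by rewrite addr_ge0 ?mulr_ge0.
rewrite -[g x](subrK (g (fun=> 0))) addrC (le_trans (ler_normD _ _)) // lerD2l.
have xK' t : `|x t| <= `|K| by apply: le_trans (xK t) (ler_norm _).
by apply: gL => // t; rewrite ?normr0 ?subr0.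
Qed.

Lemma locally_lipschitzM f g : locally_lipschitz f -> locally_lipschitz g ->
  locally_lipschitz (fun x => f x * g x).
Proof.
move=> lf lg K; have [L L0 fL] := lf K; have [M M0 gM] := lg K.
have [A A0 fA] := @locally_lipschitz_bounded _ K lf.
have [B B0 gB] := @locally_lipschitz_bounded _ K lg.
exists (L * B + A * M) => [|x y h xK yK h0 xy]; first by rewrite addr_ge0 ?mulr_ge0.
have -> : f x * g x - f y * g y = (f x - f y) * g x + f y * (g x - g y) by ring.
rewrite [leRHS]mulrDl (le_trans (ler_normD _ _)) // !normrM lerD //.
  by rewrite mulrAC ler_pM // ?fL ?gB.
by rewrite -mulrA ler_pM // ?gM ?fA.
Qed.

Lemma locally_lipschitz_sum (I : Type) (r : seq I) (f : I -> (T -> R) -> R) :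
  (forall i, locally_lipschitz (f i)) ->
  locally_lipschitz (fun x => \sum_(i <- r) f i x).
Proof.
move=> lf; elim: r => [|i r IH].
  under eq_fun do rewrite big_nil; exact: locally_lipschitz_cst.
by under eq_fun do rewrite big_cons; exact: locally_lipschitzD.
Qed.

Lemma locally_lipschitz_coefM (p q : (T -> R) -> {poly R}) :
  (forall k, locally_lipschitz (fun x => (p x)`_k)) ->
  (forall k, locally_lipschitz (fun x => (q x)`_k)) ->
  forall k, locally_lipschitz (fun x => (p x * q x)`_k).
Proof.
move=> lp lq k; under eq_fun do rewrite coefM.
by apply: locally_lipschitz_sum => i; exact: locally_lipschitzM.
Qed.

Lemma grid_approximation (K : R) (M : nat) (x : T -> R) :
  0 < K -> (forall t, `|x t| <= K) ->
  exists g : {ffun T -> 'I_M.+1}, forall t,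
    `|x t - (- K + K *+ 2 / M.+1%:R * (g t)%:R)| <= K *+ 2 / M.+1%:R.
Proof.
move=> K0 xK; set h := K *+ 2 / _.
have h0 : 0 < h by rewrite divr_gt0 ?mulrn_wgt0.
(* Rounding down to the grid; the cap at [M] handles [x t = K], where truncation gives [M.+1]. *)
exists [ffun t => inord (minn (Num.truncn ((x t + K) / h)) M)] => t; rewrite ffunE.
rewrite inordK ?ltnS ?geq_minr //.
have /ler_normlP [xl xr] := xK t.
set u := (x t + K) / h.
have u0 : 0 <= u by apply: divr_ge0; [lra|exact: ltW].
have -> : x t - (- K + h * (minn (Num.truncn u) M)%:R) =
  h * (u - (minn (Num.truncn u) M)%:R).
  by rewrite mulrBr /u mulrCA divff ?gt_eqF //; ring.
rewrite normrM (gtr0_norm h0) ler_piMr ?(ltW h0) //.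
have /andP[ul ur] := truncn_itv u0.
have [le|lt] := leqP (Num.truncn u) M.
  by move: ur; rewrite -natr1 ler_norml; lra.
have uM : u <= M.+1%:R.
  have -> : M.+1%:R = K *+ 2 / h.
    by rewrite /h invf_div mulrCA divff ?mulr1 // gt_eqF // mulrn_wgt0.
  by rewrite /u ler_pM2r ?invr_gt0 //; lra.
have Mu : M.+1%:R <= u by apply: le_trans ul; rewrite ler_nat.
by rewrite ler_norml; move: uM Mu; rewrite -natr1; lra.
Qed.

(* A grid of M^#|T| cells of side O(1/M) is mapped into boxes of total volume
   O(M^#|T| / M^n). *)
Lemma lipschitz_image_null (n : nat) (f : (T -> R) -> 'rV[R]_n) : (#|T| < n)%N ->
  (forall i, locally_lipschitz (fun x => f x ord0 i)) ->
  lebesgue_null (range f).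
Proof.
move=> Tn lf; have n0 : (0 < n)%N by apply: leq_trans Tn.
pose S j := f @` [set x | forall t, `|x t| <= j.+1%:R].
apply: (@lebesgue_null_subset _ _ _ (\bigcup_j S j)).
  move=> _ [x _ <-]; pose B := \sum_t `|x t|.
  exists (Num.truncn B) => //; exists x => // t /=.
  have B0 : 0 <= B by apply: sumr_ge0.
  have /andP[_ /ltW] := truncn_itv B0; apply: le_trans.
  by rewrite /B (bigD1 t) //= lerDl sumr_ge0.
apply: lebesgue_null_bigcup => // j; set K : R := j.+1%:R.
have K0 : 0 < K by rewrite ltr0n.
have [L L0 fL] : exists2 L : R, 0 <= L & forall i x y (h : R),
  (forall t, `|x t| <= K) -> (forall t, `|y t| <= K) -> 0 <= h ->
    (forall t, `|x t - y t| <= h) -> `|f x ord0 i - f y ord0 i| <= L * h.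
  have /choice[L LP] i : exists L : R, 0 <= L /\ forall x y (h : R),
    (forall t, `|x t| <= K) -> (forall t, `|y t| <= K) -> 0 <= h ->
    (forall t, `|x t - y t| <= h) -> `|f x ord0 i - f y ord0 i| <= L * h.
    by have [L L0 fL] := lf i K; exists L.
  exists (\sum_i L i) => [|i x y h xK yK h0 xy].
    by apply: sumr_ge0 => i _; have [] := LP i.
  have [_ /(_ x y h xK yK h0 xy) /le_trans] := LP i; apply.
  rewrite ler_wpM2r // (bigD1 i) //= lerDl sumr_ge0 // => i' _.
  by have [] := LP i'.
(* With grid step [h = 2K / M.+1], an image box has side [2 L h], hence volume [V / M.+1 ^ n]. *)
pose V := (L * (K *+ 2) *+ 2) ^+ n.
apply: lebesgue_null_countable_cover => // eps eps0.
pose M := Num.truncn (V / eps).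
pose h := K *+ 2 / M.+1%:R.
have h0 : 0 < h by rewrite divr_gt0 ?mulrn_wgt0.
pose c (g : {ffun T -> 'I_M.+1}) t : R := - K + h * (g t)%:R.
have cK (g : {ffun T -> 'I_M.+1}) t : `|c g t| <= K.
  have : h * (g t)%:R <= K *+ 2.
    rewrite /h mulrAC ler_pdivrMr // ler_pM2l ?mulrn_wgt0 // ler_nat.
    exact/ltnW/ltn_ord.
  have : 0 <= h * (g t)%:R by rewrite mulr_ge0 // ltW.
  by rewrite ler_norml /c; lra.
exists {ffun T -> 'I_M.+1}, (fun g : {ffun T -> 'I_M.+1} => f (c g) - const_mx (L * h)),
  (fun g : {ffun T -> 'I_M.+1} => f (c g) + const_mx (L * h)).
have Lh0 : 0 <= L * h by rewrite mulr_ge0 // ltW.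
split.
- by move=> g i; rewrite !mxE; lra.
- move=> _ [x xK <-]; have [g xg] := @grid_approximation K M x K0 xK.
  exists g => // i; rewrite !mxE -ler_distl.
  by apply: fL => //; exact: ltW.
move=> s us.
have vol (g : {ffun T -> 'I_M.+1}) : box_volume (f (c g) - const_mx (L * h)) (f (c g) + const_mx (L * h)) =
    V / M.+1%:R ^+ n.
  rewrite /box_volume (eq_bigr (fun=> L * (K *+ 2) *+ 2 / M.+1%:R)).
    by rewrite prodr_const card_ord expr_div_n.
  by move=> i _; rewrite !mxE /h mulrnAl -mulrA; ring.
have V0 : 0 <= V by rewrite exprn_ge0 // mulrn_wge0 // mulr_ge0 // ltW ?mulrn_wgt0.
apply: le_trans (ler_sum_uniq_subset (t := index_enum _) _ us _) _ => //.
  by move=> g; rewrite vol; exact: divr_ge0.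
rewrite (eq_bigr _ (fun k _ => vol k)) sumr_const card_ffun card_ord.
have Vle : V / M.+1%:R <= eps.
  have /andP[_ /ltW] := truncn_itv (divr_ge0 V0 (ltW eps0)).
  by rewrite ler_pdivrMr // ler_pdivrMr // mulrC.
apply: le_trans Vle.
(* There are [M.+1 ^ #|T|] boxes; [#|T| < n] leaves a factor [M.+1] in the denominator. *)
rewrite -[leLHS]mulr_natr natrX -mulrA ler_wpM2l //.
rewrite mulrC ler_pdivrMr ?exprn_gt0 // ler_pdivlMl // -exprS.
by rewrite ler_weXn2l ?ler1n.
Qed.
End LocallyLipschitz.

(** * Nullity of the discriminant hypersurface *)

Section Discriminant.
Variable R : realType.

(** In characteristic zero nonconstant polynomials have nonzero derivative, so nonseparability comes
    from non-coprime [u], [v] with [u * v] dividing [p]. The square of their gcd divides [p]; [F] is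
    that gcd made monic. *)
Lemma nonseparable_square_factor (p : {poly R}) : p != 0 -> ~~ separable_poly p ->
  exists F V : {poly R}, [/\ F \is monic, (1 < size F)%N & p = F * F * V].
Proof.
move=> p0 nsep.
have [u [v [uvp ncop]]] : exists u v : {poly R}, u * v %| p /\ ~~ coprimep u v.
  apply: contrapT => H; move/negP: nsep; apply; apply/separable_polyP; split.
    by move=> u v uvp; apply/negPn/negP => ncop; apply: H; exists u, v.
  move=> u _ su; apply/eqP => /polyP/(_ (size u).-2).
  rewrite coef_deriv coef0 -mulr_natr prednK ?prednK -?subn1 ?subn_gt0 ?(ltnW su) //.
  move/eqP; rewrite mulf_eq0 pnatr_eq0 subn1 -lead_coefE lead_coef_eq0.
  by rewrite -size_poly_eq0; lia.
pose g := gcdp u v.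
have g0 : g != 0.
  rewrite gcdp_eq0; apply: contra p0 => /andP[/eqP u0 _].
  by move: uvp; rewrite u0 mul0r dvd0p.
have ggp : g * g %| p.
  by apply: dvdp_trans uvp; rewrite dvdp_mul ?dvdp_gcdl ?dvdp_gcdr.
have lg0 : lead_coef g != 0 by rewrite lead_coef_eq0.
pose F := (lead_coef g)^-1 *: g.
have FFp : F * F %| p.
  by rewrite /F -scalerAl -scalerAr !dvdpZl ?invr_eq0.
exists F, (p %/ (F * F)); split.
- by rewrite monicE lead_coefZ mulVf.
- rewrite size_scale ?invr_eq0 // ltn_neqAle eq_sym size_poly_gt0 g0 andbT.
  by move: ncop; rewrite /coprimep.
by rewrite mulrC divpK.
Qed.

Variable d : nat.
Hypothesis d_gt0 : (0 < d)%N.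
Local Notation N := (Npar d).
Implicit Types theta : 'rV[R]_N.

Lemma ptheta_poly theta :
  ptheta theta = \poly_(i < d.+1) th theta i (d - i).
Proof.
rewrite /ptheta poly_def (reindex_inj rev_ord_inj) /=.
by apply: eq_bigr => k _; rewrite subSS subKn // -ltnS.
Qed.

Lemma size_ptheta theta : th theta d 0 != 0 -> size (ptheta theta) = d.+1.
Proof. by move=> h; rewrite ptheta_poly size_poly_eq // subnn. Qed.

(** The sign and the nonzero leading coefficient do not affect vanishing, and the resultant vanishes
    exactly when [p] and its derivative have a nonconstant gcd. *)
Lemma Dtheta_eq0 theta : th theta d 0 != 0 ->
  (Dtheta theta == 0) = ~~ separable_poly (ptheta theta).
Proof.
move=> h; have p0 : ptheta theta != 0 by rewrite -size_poly_gt0 size_ptheta.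
rewrite /Dtheta !mulf_eq0 signr_eq0 invr_eq0 lead_coef_eq0 (negbTE p0) orbF /=.
rewrite resultant_eq0 separable_poly.unlock /coprimep ltn_neqAle eq_sym.
by rewrite size_poly_gt0 gcdp_eq0 (negbTE p0) andbT.
Qed.

Lemma lead_index_subproof :
  (0 < (@ord_max d, @ord0 d).1 + (@ord_max d, @ord0 d).2 <= d)%N.
Proof. by rewrite /= addn0 d_gt0 leqnn. Qed.

(** Position of the coefficient theta_{d-k,k}; for [k > d] the default is the position of
    theta_{d0}. *)
Definition top_index (k : nat) : 'I_N :=
  enum_rank (insubd (Sub (@ord_max d, @ord0 d) lead_index_subproof : idx d)
    (inord (d - k), inord k)).

Lemma top_indexP k : (k <= d)%N ->
  (0 < (inord (d - k) : 'I_d.+1) + (inord k : 'I_d.+1) <= d)%N.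
Proof. by move=> kd; rewrite !inordK ?ltnS ?leq_subr // subnK // d_gt0 leqnn. Qed.

Lemma th_top theta k : (k <= d)%N -> th theta (d - k) k = theta ord0 (top_index k).
Proof.
move=> kd; rewrite /th /top_index /insubd.
by case: insubP => //= /negP[]; exact: top_indexP.
Qed.

Lemma val_enum_val_top k : (k <= d)%N ->
  val (enum_val (top_index k)) = (inord (d - k), inord k).
Proof. by move=> kd; rewrite enum_rankK val_insubd top_indexP. Qed.

Lemma top_index_eq0 k : (0 < k <= d)%N -> top_index k != top_index 0.
Proof.
move=> /andP[k0 kd]; apply/eqP => /(congr1 (fun n => val (enum_val n))).
rewrite !val_enum_val_top // => -[_ /(congr1 val)] /=.
by rewrite !inordK ?ltnS // => k0'; rewrite k0' in k0.
Qed.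

(* Free coordinates of the maps below: all but the one of theta_{d0}. *)
Definition free_index : finType := {n : 'I_N | n != top_index 0}.

Lemma card_free_index : (#|free_index| < N)%N.
Proof.
rewrite card_sig -[X in (#|X| < _)%N]/(predC1 (top_index 0)) cardC1 card_ord.
by rewrite prednK // (leq_ltn_trans _ (ltn_ord (top_index 0))).
Qed.

Definition free_coord (x : free_index -> R) (n : 'I_N) : R := oapp x 0 (insub n).

Lemma locally_lipschitz_free_coord n : locally_lipschitz (fun x => free_coord x n).
Proof.
rewrite /free_coord; case: insubP => [t _ _|_] /=.
  exact: locally_lipschitz_proj.
exact: locally_lipschitz_cst.
Qed.

(** For [e <= d], the lower coefficients of this monic factor occupy positions [1..e] and those of
    the cofactor positions [e+1..d], so the two vary independently. *)
Definition sq_factor e (x : free_index -> R) : {poly R} :=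
  \poly_(l < e.+1) (if l == e then 1 else free_coord x (top_index l.+1)).

Definition cofactor_poly e (x : free_index -> R) : {poly R} :=
  \poly_(l < d - e) free_coord x (top_index (e + l).+1).

(* For e >= 1, a monic F of degree e takes e of the d coordinates
   theta_{d-k,k}, k >= 1, and V such that F^2 V has degree d takes
   d - 2e + 1 <= d - e of them. *)
Definition square_map e (x : free_index -> R) : 'rV[R]_N :=
  \row_(n < N) let ij := val (enum_val n : idx d) in
    if (ij.1 + ij.2 == d)%N
    then (sq_factor e x * sq_factor e x * cofactor_poly e x)`_ij.1
    else free_coord x n.

Lemma locally_lipschitz_square_map e n :
  locally_lipschitz (fun x => square_map e x ord0 n).
Proof.
have lF k : locally_lipschitz (fun x => (sq_factor e x)`_k).
  under eq_fun do rewrite coef_poly.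
  case: (k < e.+1)%N; last exact: locally_lipschitz_cst.
  case: (k == e); first exact: locally_lipschitz_cst.
  exact: locally_lipschitz_free_coord.
have lV k : locally_lipschitz (fun x => (cofactor_poly e x)`_k).
  under eq_fun do rewrite coef_poly.
  case: (k < d - e)%N; last exact: locally_lipschitz_cst.
  exact: locally_lipschitz_free_coord.
under eq_fun do rewrite mxE /=.
case: (_ == d); last exact: locally_lipschitz_free_coord.
apply: locally_lipschitz_coefM => // k.
exact: locally_lipschitz_coefM.
Qed.

Lemma nonseparable_in_square_map theta :
  th theta d 0 != 0 -> ~~ separable_poly (ptheta theta) ->
  exists e, range (square_map e) theta.
Proof.
move=> h nsep; have sp := size_ptheta h.
have p0 : ptheta theta != 0 by rewrite -size_poly_gt0 sp.
have [F [V [Fmon sF pE]]] := nonseparable_square_factor p0 nsep.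
pose e := (size F).-1.
have sFe : size F = e.+1 by rewrite prednK // ltnW.
have e0 : (0 < e)%N by rewrite -ltnS -sFe.
have F0 : F != 0 by rewrite monic_neq0.
have V0 : V != 0 by apply: contra p0 => /eqP V0; rewrite pE V0 mulr0.
have sV : (e + e + size V = d.+1)%N.
  by rewrite -sp pE !size_mul ?mulf_neq0 // sFe !addnS.
(* Since [size V = d + 1 - 2e], this uses [1 <= e]: the square factor saves the coordinate of
   theta_{d0}. *)
have sVle : (size V <= d - e)%N by lia.
have ed : (e < d)%N by move: V0; rewrite -size_poly_gt0; lia.
(* Inverse of the layout above; the meaningless value at theta_{d0} disappears on restriction to
   [free_index]. *)
pose y (n : 'I_N) := let ij := val (enum_val n : idx d) in
  if (ij.1 + ij.2 == d)%N
  then (if (ij.2 <= e)%N then F`_(ij.2).-1 else V`_(ij.2 - e.+1))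
  else theta ord0 n.
pose x (t : free_index) := y (val t).
have xy n : n != top_index 0 -> free_coord x n = y n.
  by move=> n0; rewrite /free_coord insubT.
have ytop k : (k <= d)%N -> y (top_index k) =
    if (k <= e)%N then F`_k.-1 else V`_(k - e.+1).
  move=> kd; rewrite /y val_enum_val_top //= !inordK ?ltnS ?leq_subr //.
  by rewrite subnK // eqxx.
have FE : sq_factor e x = F.
  apply/polyP => i; rewrite coef_poly; case: ifPn => [ie|]; last first.
    by rewrite -leqNgt => ie; rewrite nth_default ?sFe.
  case: eqP => [->|/eqP ine]; first by move/monicP: Fmon; rewrite lead_coefE.
  have ie' : (i < e)%N by rewrite ltn_neqAle ine -ltnS.
  by rewrite xy ?top_index_eq0 ?ytop /= ?ie' //; lia.
have VE : cofactor_poly e x = V.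
  apply/polyP => i; rewrite coef_poly; case: ifPn => [ie|]; last first.
    by rewrite -leqNgt => ie; rewrite nth_default // (leq_trans sVle).
  rewrite xy ?top_index_eq0 ?ytop /=; try lia.
  by rewrite leqNgt ltnS leq_addr /= subSS addKn.
exists e, x => //; apply/rowP => n; rewrite mxE /= FE VE -pE.
set ij := val (enum_val n).
have [ijd|ijd] := eqVneq (ij.1 + ij.2)%N d.
  have id : (ij.1 <= d)%N by rewrite -ltnS.
  rewrite ptheta_poly coef_poly ltnS id -{1}(subKn id) th_top ?leq_subr //.
  congr (theta _ _); apply: enum_val_inj; apply: val_inj.
  rewrite val_enum_val_top ?leq_subr // subKn // -/ij.
  rewrite [RHS]surjective_pairing; congr (_, _); apply: val_inj; rewrite /= inordK ?ltnS ?leq_subr //.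
  by apply/eqP; rewrite -(eqn_add2l ij.1) subnKC // eq_sym; apply/eqP.
rewrite xy /y -/ij ?(negbTE ijd) //.
apply: contra ijd => /eqP nE; rewrite /ij nE val_enum_val_top //=.
by rewrite !inordK ?ltnS ?subn0 ?addn0.
Qed.

Lemma discriminant_null :
  lebesgue_null [set theta : 'rV[R]_N | th theta d 0 < 0 /\ Dtheta theta = 0].
Proof.
have N0 : (0 < N)%N by apply: leq_trans card_free_index.
apply: (@lebesgue_null_subset _ _ _ (\bigcup_e range (square_map e))); last first.
  apply: lebesgue_null_bigcup => // e; apply: lipschitz_image_null.
    exact: card_free_index.
  exact: locally_lipschitz_square_map.
move=> theta [/lt_eqF/negbT h /eqP]; rewrite Dtheta_eq0 // => nsep.
by have [e H] := nonseparable_in_square_map h nsep; exists e.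
Qed.

End Discriminant.

(** * Negativity on the half-line as an open and relatively closed condition *)

Section Negativity.
Variables (R : realType) (d : nat).
Implicit Types theta : 'rV[R]_(Npar d).

(** The exponent map [m] covers both [p] ([subn d]) and its reversal [a^d p(1/a)] ([id]). *)
Definition top_form theta (m : nat -> nat) (a : R) : R :=
  \sum_(k < d.+1) th theta (d - k) k * a ^+ m k.

Lemma top_form_dist theta theta' m (a r : R) : 0 <= a -> ball theta r theta' ->
  `|top_form theta m a - top_form theta' m a| <= (\sum_(k < d.+1) a ^+ m k) * r.
Proof.
move=> a0 [r0 near_theta].
have thr i j : `|th theta i j - th theta' i j| <= r.
  rewrite /th; case: insub => [ij|]; last by rewrite subrr normr0 ltW.
  exact/ltW/near_theta.
rewrite /top_form -sumrB (le_trans (ler_norm_sum _ _ _)) // mulr_suml.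
apply: ler_sum => k _; rewrite -mulrBl normrM mulrC (ger0_norm (exprn_ge0 _ a0)).
by rewrite ler_wpM2l // exprn_ge0.
Qed.

Lemma horner_ptheta theta a : (ptheta theta).[a] = top_form theta (subn d) a.
Proof.
by rewrite horner_sum; apply: eq_bigr => k _; rewrite hornerZ hornerXn.
Qed.

Lemma top_form_rev theta (a : R) : 0 < a ->
  top_form theta (subn d) a = a ^+ d * top_form theta id a^-1.
Proof.
move=> a0; rewrite mulr_sumr; apply: eq_bigr => k _.
by rewrite mulrCA exprVn -expfB_cond // gt_eqF //= add0n -ltnS; exact: ltn_ord.
Qed.

Lemma open_top_form_negative m :
  open [set theta | forall a : R, 0 <= a <= 1 -> top_form theta m a < 0].
Proof.
rewrite openE => theta /= neg.
pose q : {poly R} := \sum_(k < d.+1) th theta (d - k) k *: 'X^(m k).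
have qE a : q.[a] = top_form theta m a.
  by rewrite horner_sum; apply: eq_bigr => k _; rewrite hornerZ hornerXn.
have [|c c01 cmax] := @EVT_max R (horner q) 0 1 ler01.
  by apply: continuous_subspaceT => x; exact: continuous_horner.
have qc : 0 < - q.[c] by rewrite oppr_gt0 qE neg // -in_itv.
(* On [[0, 1]] the [d.+1] powers are at most [1], so this radius moves values by less than the gap
   [- q.[c]]. *)
apply/nbhs_ballP; exists (- q.[c] / d.+2%:R) => /=; first by rewrite divr_gt0.
move=> theta' near_theta a a01; have /andP[a0 a1] := a01.
have := top_form_dist m a0 near_theta.
have sle : \sum_(k < d.+1) a ^+ m k <= d.+1%:R.
  rewrite -[in leRHS](card_ord d.+1) -sumr_const; apply: ler_sum => k _.
  by rewrite exprn_ile1.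
rewrite distrC => /(le_trans (ler_norm _)) dist.
have := cmax a; rewrite in_itv /= => /(_ a01); rewrite qE => qa.
have lt : (\sum_(k < d.+1) a ^+ m k) * (- q.[c] / d.+2%:R) < - q.[c].
  rewrite mulrCA gtr_pMr // ltr_pdivrMr // mul1r (le_lt_trans sle) //.
  by rewrite ltr_nat.
by have := le_lt_trans dist lt; lra.
Qed.

(** Inversion sends []1, +oo[] into [[0, 1]]; the values at [0] of [p] and of its reversal are
    theta_{0d} and theta_{d0}. *)
Lemma Theta1E : @Theta1 R d =
  [set theta | forall a : R, 0 <= a <= 1 -> top_form theta (subn d) a < 0] `&`
  [set theta | forall a : R, 0 <= a <= 1 -> top_form theta id a < 0].
Proof.
apply/seteqP; split=> theta /=.
  move=> [neg [_ lead_neg]]; split=> a /andP[a0 a1].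
    by rewrite -horner_ptheta neg.
  move: a0; rewrite le_eqVlt => /predU1P[<-|a0].
    rewrite /top_form big_ord_recl big1 ?addr0 /= ?subn0 ?mulr1 //.
    by move=> k _; rewrite expr0n /= mulr0.
  have /neg : 0 <= a^-1 by rewrite invr_ge0 ltW.
  rewrite horner_ptheta top_form_rev ?invr_gt0 // invrK pmulr_rlt0 //.
  by rewrite exprn_gt0 ?invr_gt0.
move=> [neg rneg]; split.
  move=> a a0; rewrite horner_ptheta.
  have [a1|a1] := leP a 1; first by rewrite neg ?a0.
  have a_gt0 : 0 < a by exact: lt_trans a1.
  rewrite top_form_rev // pmulr_rlt0 ?exprn_gt0 // rneg // invr_ge0 a0 /=.
  by rewrite invf_le1 // ltW.
have z01 : (0 : R) <= (0 : R) <= (1 : R) by rewrite lexx ler01.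
split.
  have := neg 0 z01; rewrite /top_form big_ord_recr big1 /= ?add0r ?subnn ?mulr1 //.
  by move=> k _; rewrite expr0n subn_eq0 leqNgt ltn_ord mulr0.
have := rneg 0 z01; rewrite /top_form big_ord_recl big1 ?addr0 /= ?subn0 ?mulr1 //.
by move=> k _; rewrite expr0n /= mulr0.
Qed.

Lemma open_Theta1 : open (@Theta1 R d).
Proof. by rewrite Theta1E; apply: openI; exact: open_top_form_negative. Qed.

Lemma closed_ptheta_nonpositive :
  closed [set theta : 'rV[R]_(Npar d) | forall a : R, 0 <= a -> (ptheta theta).[a] <= 0].
Proof.
rewrite -openC openE => theta /= /existsNP[a /not_implyP[a0 /negP]].
rewrite -ltNge => pa; set s := \sum_(k < d.+1) a ^+ (d - k).
have s0 : 0 <= s by apply: sumr_ge0 => k _; rewrite exprn_ge0.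
(* At [a] the perturbation is at most [s] times the radius, hence less than [p(a)]; [s + 1] is
   positive. *)
apply/nbhs_ballP; exists ((ptheta theta).[a] / (s + 1)) => /=.
  by rewrite divr_gt0 // ltr_wpDl.
move=> theta' near_theta /(_ a a0).
have := top_form_dist (subn d) a0 near_theta; rewrite -/s.
move=> /(le_trans (ler_norm _)); rewrite -!horner_ptheta => dist.
have lt : s * ((ptheta theta).[a] / (s + 1)) < (ptheta theta).[a].
  by rewrite mulrCA gtr_pMr // ltr_pdivrMr ?mul1r ?ltrDl // ltr_wpDl.
by have := le_lt_trans dist lt; lra.
Qed.

(* A zero of a polynomial that is nonpositive on the half-line is a local
   maximum, hence a double root. *)
Lemma nonpositive_separable_negative (p : {poly R}) : separable_poly p ->
  (forall a, 0 <= a -> p.[a] <= 0) -> forall a, 0 < a -> p.[a] < 0.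
Proof.
move=> sep le0 a a0; rewrite lt_neqAle le0 ?(ltW a0) // andbT; apply/negP => /eqP pa.
have da0 : is_derive a (1 : R) (horner p) 0.
  apply: (@derive1_at_max R (horner p) 0 (a + 1) a).
  - by lra.
  - by move=> t _; exact: derivable_horner.
  - by rewrite in_itv /= a0; lra.
  - by move=> t; rewrite in_itv /= pa => /andP[t0 _]; rewrite le0 // ltW.
have pa0 : root p a by apply/eqP.
move: sep; rewrite separable_poly.unlock => /coprimep_root /(_ pa0).
rewrite -(@derive_val _ _ _ _ _ _ _ (is_derive_poly p a)).
by rewrite (@derive_val _ _ _ _ _ _ _ da0) eqxx.
Qed.

Lemma Theta1_of_nonpositive theta : @Theta2 R d theta ->
  (forall a : R, 0 <= a -> (ptheta theta).[a] <= 0) -> @Theta1 R d theta.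
Proof.
move=> [[lead0 const0] /eqP]; rewrite Dtheta_eq0 ?lt_eqF // negbK => sep le0.
(* The local maximum argument needs an interior point; at [0] the value is theta_{0d}. *)
split=> // a; rewrite le_eqVlt => /predU1P[<-|a0].
  by rewrite horner_coef0 ptheta_poly coef_poly /= subn0.
exact: nonpositive_separable_negative.
Qed.

(** Inside [Theta2], the open set [Theta1] is cut out by the closed condition [p <= 0] on the
    half-line, so a connected component meeting it is contained in it. *)
Lemma Theta2_star_sub : @Theta2_star R d `<=` @Theta1 R d.
Proof.
move=> theta [th2 [theta1 [C1 T1]]].
set C := connected_component (@Theta2 R d) theta in C1.
suff CE : C `&` @Theta1 R d = C.
  have : C theta by exact: connected_component_refl.
  by rewrite -CE => -[].
apply: (@component_connected _ (@Theta2 R d) theta).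
- by exists theta1.
- by exists (@Theta1 R d) => //; exact: open_Theta1.
- eexists; first exact: closed_ptheta_nonpositive.
  apply/seteqP; split=> t [Ct]; last first.
    move=> le0; split=> //; apply: Theta1_of_nonpositive => //.
    exact: connected_component_sub Ct.
  by move=> [neg _]; split=> // a a0; rewrite ltW ?neg.
Qed.

End Negativity.

Unset Implicit Arguments.

Theorem theorem6p3 (R : realType) (d : nat) (hd : (2 <= d)%N) :
  lebesgue_null
    ((@Theta1 R d `\` @Theta2_star R d) `|` (@Theta2_star R d `\` @Theta1 R d)).
Proof.
apply: (lebesgue_null_subset _ (@discriminant_null R d (ltnW hd))) => theta.
case=> [[T1 nT2]|[/Theta2_star_sub T1 nT1]//].
have [_ [const0 lead0]] := T1; split=> //.
(* A point of [Theta1] with nonzero discriminant lies in [Theta2], and its component meets [Theta1]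
   at the point itself. *)
apply: contrapT => D0; apply: nT2.
have T2 : @Theta2 R d theta by [].
by split=> //; exists theta; split=> //; exact: connected_component_refl.
Qed.
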